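(* Let $\mathcal{U}=\{u\in\mathbb{R}^L:\|u\|_2\le 1\}$, let $S_l\in\mathbb{R}^{n\times n}$, $q_l\in\mathbb{R}^n$, $C_l\in\mathbb{R}^{m\times n}$, $b_l\in\mathbb{R}^m$ for $l=0,1,\dots,L$, and for $u\in\mathcal{U}$ let $$S(u)=S_0+\sum_{l=1}^Lu_lS_l,\quad M(u)=S(u)^TS(u),\quad q(u)=q_0+\sum_{l=1}^Lu_lq_l,\quad C(u)=C_0+\sum_{l=1}^Lu_lC_l,\quad b(u)=b_0+\sum_{l=1}^Lu_lb_l.$$ Consider the uncertain variational inequality problem $\{\mathrm{VI}(X(u),F(\cdot,u))\}_{u\in\mathcal{U}}$ with $X(u)=\{x\in\mathbb{R}^n: C(u)x\ge b(u),\ x\ge 0\}$ and $F(x,u)=M(u)x+q(u)$. Then a robust solution of this problem is given by a solution to a tractable convex program.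
   Context: Vector inequalities are componentwise. $\mathrm{VI}(X,F)$ asks for $x\in X$ with $(y-x)^TF(x)\ge0$ for all $y\in X$. For each $u$, $x$ solves $\mathrm{VI}(X(u),F(\cdot,u))$ if and only if there is $\lambda\in\mathbb{R}^m$ such that $z=(x,\lambda)$ solves the linear complementarity problem $0\le z\perp B(u)z+d(u)\ge0$, where $$B(u)=\begin{pmatrix}M(u)&-C(u)^T\\ C(u)&0\end{pmatrix},\qquad d(u)=\begin{pmatrix}q(u)\\-b(u)\end{pmatrix}.$$ A robust solution of the uncertain variational inequality problem is a solution of the robust counterpart of this uncertain linear complementarity problem, i.e. (in the variables $z=(x,\lambda)\in\mathbb{R}^{n+m}$ and $t\in\mathbb{R}$) $$\begin{array}{rl}\min & t\\ \text{subject to} & z^T(B(u)z+d(u))\le t,\quad\forall u\in\mathcal{U},\\ & M(u)x-C(u)^T\lambda+q(u)\ge0,\quad\forall u\in\mathcal{U},\\ & C(u)x-b(u)\ge0,\quad\forall u\in\mathcal{U},\\ & x,\lambda\ge0.\end{array}$$ A tractable convex program here is a single finite-dimensional convex optimization problem in variables $(z,t,w)$ ($w$ a finite vector of additional variables) with linear or convex quadratic objective and finitely many constraints, each an affine (in)equality, a convex quadratic inequality, a second-order cone constraint, or a linear matrix inequality. That its solutions give robust solutions means it is equivalent to the robust counterpart: $(z,t)$ is feasible for the robust counterpart if and only if there is $w$ such that $(z,t,w)$ is feasible for the convex program, the objectives both being $t$. *)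

(* Defs.v *)
From mathcomp Require Import all_boot all_order all_algebra.
From mathcomp Require Import classical_sets reals lra.

Set Implicit Arguments.
Unset Strict Implicit.
Unset Printing Implicit Defensive.
Import Order.TTheory GRing.Theory Num.Theory.
Local Open Scope ring_scope.

Section Vectors.
Variable R : realType.

Definition dotv (p : nat) (u v : 'cV[R]_p) : R := (u^T *m v) 0 0.

Lemma dotvDr p (u v w : 'cV[R]_p) : dotv u (v + w) = dotv u v + dotv u w.
Proof. by rewrite /dotv mulmxDr mxE. Qed.

Lemma dotvNr p (u v : 'cV[R]_p) : dotv u (- v) = - dotv u v.
Proof. by rewrite /dotv mulmxN mxE. Qed.

Lemma dotvC p (u v : 'cV[R]_p) : dotv u v = dotv v u.
Proof. by rewrite /dotv -[in LHS](trmxK v) -trmx_mul mxE. Qed.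

Lemma dotvBl p (u v w : 'cV[R]_p) : dotv (u - v) w = dotv u w - dotv v w.
Proof. by rewrite dotvC dotvDr dotvNr !(dotvC w). Qed.

Lemma dotv_mull p r (A : 'M[R]_(p, r)) (u : 'cV[R]_r) (v : 'cV[R]_p) :
  dotv (A *m u) v = dotv u (A^T *m v).
Proof. by rewrite /dotv trmx_mul mulmxA. Qed.

(* MathComp-Analysis equips matrices with the sup norm, hence this one. *)
Definition norm2 (p : nat) (u : 'cV[R]_p) : R := Num.sqrt (dotv u u).

Definition vle (p : nat) (u v : 'cV[R]_p) : Prop := forall i, u i 0 <= v i 0.

Definition psdmx (p : nat) (A : 'M[R]_p) : Prop :=
  A^T = A /\ forall v : 'cV[R]_p, 0 <= dotv v (A *m v).

Definition unit_ball2 (L : nat) : set 'cV[R]_L := [set u | norm2 u <= 1]%classic.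

(* A_0 + \sum_(l = 1..L) u_l A_l; the coordinate u_l of the text is
   [u (l-1) 0] and A_l is [A (lift ord0 (l-1))]. *)
Definition affine_family (L : nat) (E : lmodType R) (A : 'I_L.+1 -> E)
    (u : 'cV[R]_L) : E :=
  A ord0 + \sum_(l < L) u l 0 *: A (lift ord0 l).

Definition minimizer (T : Type) (feasible : T -> Prop) (f : T -> R) (v : T) :=
  feasible v /\ forall v', feasible v' -> f v <= f v'.

End Vectors.

Section RobustVI.
Variable R : realType.

Definition solves_VI (n : nat) (X : set 'cV[R]_n) (F : 'cV[R]_n -> 'cV[R]_n)
    (x : 'cV[R]_n) : Prop :=
  X x /\ forall y, X y -> 0 <= dotv (y - x) (F x).

Definition solves_LCP (p : nat) (B : 'M[R]_p) (d z : 'cV[R]_p) : Prop :=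
  [/\ vle 0 z, vle 0 (B *m z + d) & dotv z (B *m z + d) = 0].

(* The variational inequality VI(X, F) with X = {x | C x >= b, x >= 0} and
   F x = M x + q. *)
Record affineVI (n m : nat) := AffineVI {
  vi_M : 'M[R]_n;
  vi_q : 'cV[R]_n;
  vi_C : 'M[R]_(m, n);
  vi_b : 'cV[R]_m }.

Section FixedVI.
Variables (n m : nat) (V : affineVI n m).

Definition vi_set : set 'cV[R]_n :=
  [set x | vle (vi_b V) (vi_C V *m x) /\ vle 0 x]%classic.

Definition vi_map (x : 'cV[R]_n) : 'cV[R]_n := vi_M V *m x + vi_q V.

Definition lcp_B : 'M[R]_(n + m) :=
  block_mx (vi_M V) (- (vi_C V)^T) (vi_C V) 0.

Definition lcp_d : 'cV[R]_(n + m) := col_mx (vi_q V) (- vi_b V).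

(* The LCP of V is its KKT system; this is the elementary half of the
   equivalence between the two problems. *)
Lemma solves_LCP_VI (x : 'cV[R]_n) (lam : 'cV[R]_m) :
  solves_LCP lcp_B lcp_d (col_mx x lam) -> solves_VI vi_set vi_map x.
Proof.
rewrite /lcp_B /lcp_d /solves_LCP mul_block_col mul0mx addr0 add_col_mx.
have dotv_ge0 p (u v : 'cV[R]_p) : vle 0 u -> vle 0 v -> 0 <= dotv u v.
  move=> u0 v0; rewrite /dotv mxE sumr_ge0 // => i _; rewrite mxE mulr_ge0 //.
    by have := u0 i; rewrite mxE.
  by have := v0 i; rewrite mxE.
move=> [z0 s0 zs].
have x0 : vle 0 x by move=> i; have := z0 (lshift m i); rewrite col_mxEu !mxE.
have l0 : vle 0 lam.
  by move=> i; have := z0 (rshift n i); rewrite col_mxEd !mxE.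
have sx0 : vle 0 (vi_M V *m x + - (vi_C V)^T *m lam + vi_q V).
  by move=> i; have := s0 (lshift m i); rewrite col_mxEu mxE [(0 : 'cV_n) _ _]mxE.
have sl0 : vle 0 (vi_C V *m x - vi_b V).
  by move=> i; have := s0 (rshift n i); rewrite col_mxEd mxE [(0 : 'cV_m) _ _]mxE.
split=> [|y [Cy y0]].
  by split=> // i; have := sl0 i; rewrite !mxE subr_ge0.
have Cyb : vle 0 (vi_C V *m y - vi_b V).
  by move=> i; have := Cy i; rewrite !mxE subr_ge0.
have := addr_ge0 (dotv_ge0 _ _ _ y0 sx0) (dotv_ge0 _ _ _ l0 Cyb).
have trE (v : 'cV[R]_n) :
    dotv v (- (vi_C V)^T *m lam) = - dotv lam (vi_C V *m v).
  by rewrite mulNmx dotvNr dotvC dotv_mull trmxK dotvC.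
have := zs; rewrite /dotv tr_col_mx mul_row_col mxE -!/(dotv _ _).
rewrite /vi_map !dotvDr !trE !dotvNr !dotvBl.
lra.
Qed.

End FixedVI.

(* Robust counterpart, over the uncertainty set U, of the uncertain LCP with
   data (B u, d u): minimize t subject to [rc_feasible]. *)
Definition rc_feasible (L p : nat) (U : set 'cV[R]_L)
    (B : 'cV[R]_L -> 'M[R]_p) (d : 'cV[R]_L -> 'cV[R]_p)
    (zt : 'cV[R]_p * R) : Prop :=
  [/\ forall u, U u -> dotv zt.1 (B u *m zt.1 + d u) <= zt.2,
      forall u, U u -> vle 0 (B u *m zt.1 + d u)
    & vle 0 zt.1].

Definition robust_feasible (L n m : nat) (U : set 'cV[R]_L)
    (V : 'cV[R]_L -> affineVI n m) : 'cV[R]_(n + m) * R -> Prop :=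
  rc_feasible U (fun u => lcp_B (V u)) (fun u => lcp_d (V u)).

(* Robust solution z = (x, lambda), with optimal value t, of the uncertain
   variational inequality (V u) for u in U. *)
Definition robust_solution (L n m : nat) (U : set 'cV[R]_L)
    (V : 'cV[R]_L -> affineVI n m) (z : 'cV[R]_(n + m)) (t : R) : Prop :=
  minimizer (robust_feasible U V) snd (z, t).

Lemma robust_feasibleE (L n m : nat) (U : set 'cV[R]_L)
    (V : 'cV[R]_L -> affineVI n m) (x : 'cV[R]_n) (lam : 'cV[R]_m) (t : R) :
  let z := col_mx x lam in
  robust_feasible U V (z, t) <->
  [/\ forall u, U u -> dotv z (lcp_B (V u) *m z + lcp_d (V u)) <= t,
      forall u, U u ->
        vle 0 (vi_M (V u) *m x - (vi_C (V u))^T *m lam + vi_q (V u)),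
      forall u, U u -> vle 0 (vi_C (V u) *m x - vi_b (V u))
    & vle 0 x /\ vle 0 lam].
Proof.
have vle_col (y1 : 'cV[R]_n) (y2 : 'cV[R]_m) :
    vle 0 (col_mx y1 y2) <-> vle 0 y1 /\ vle 0 y2.
  split=> [h|[h1 h2] i].
    split=> i; [have := h (lshift m i) | have := h (rshift n i)].
      by rewrite col_mxEu !mxE.
    by rewrite col_mxEd !mxE.
  rewrite [leLHS]mxE; case: (split_ordP i) => j ->.
    by rewrite col_mxEu; have := h1 j; rewrite [leLHS]mxE.
  by rewrite col_mxEd; have := h2 j; rewrite [leLHS]mxE.
have lcpE u : lcp_B (V u) *m col_mx x lam + lcp_d (V u) =
    col_mx (vi_M (V u) *m x - (vi_C (V u))^T *m lam + vi_q (V u))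
           (vi_C (V u) *m x - vi_b (V u)).
  by rewrite /lcp_B /lcp_d mul_block_col mul0mx addr0 mulNmx add_col_mx.
split=> /=.
  move=> [/= h1 h2 /vle_col h3]; split=> // u Uu;
    by have := h2 u Uu; rewrite lcpE => /vle_col [].
move=> [h1 h2 h3 h4]; split=> //=; last exact/vle_col.
by move=> u Uu; rewrite lcpE; apply/vle_col; split; [exact: h2|exact: h3].
Qed.

End RobustVI.

Section ConvexPrograms.
Variable R : realType.

(* Constraints on v in R^N:
   a^T v = c;   a^T v <= c;   v^T Q v + a^T v <= c with Q psd;
   |A v + h|_2 <= a^T v + c;   G0 + \sum_i v_i G_i psd. *)
Inductive convex_constraint (N : nat) :=
| AffineEq (a : 'cV[R]_N) (c : R)
| AffineLe (a : 'cV[R]_N) (c : R)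
| ConvexQuadratic (Q : 'M[R]_N) (Qpsd : psdmx Q) (a : 'cV[R]_N) (c : R)
| SecondOrderCone (p : nat) (A : 'M[R]_(p, N)) (h : 'cV[R]_p)
    (a : 'cV[R]_N) (c : R)
| LinearMatrixIneq (p : nat) (G0 : 'M[R]_p) (G : 'I_N -> 'M[R]_p)
    (G0sym : G0^T = G0) (Gsym : forall i, (G i)^T = G i).

Definition satisfies (N : nat) (k : convex_constraint N) (v : 'cV[R]_N) : Prop :=
  match k with
  | AffineEq a c => dotv a v = c
  | AffineLe a c => dotv a v <= c
  | ConvexQuadratic Q _ a c => dotv v (Q *m v) + dotv a v <= c
  | SecondOrderCone _ A h a c => norm2 (A *m v + h) <= dotv a v + c
  | LinearMatrixIneq _ G0 G _ _ => psdmx (G0 + \sum_(i < N) v i 0 *: G i)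
  end.

(* Objective v^T Q v + a^T v + c with Q psd (Q = 0 is the linear case). *)
Record convex_program (N : nat) := ConvexProgram {
  cp_Q : 'M[R]_N;
  cp_Qpsd : psdmx cp_Q;
  cp_a : 'cV[R]_N;
  cp_c : R;
  cp_constraints : seq (convex_constraint N) }.

Definition cp_objective (N : nat) (P : convex_program N) (v : 'cV[R]_N) : R :=
  dotv v (cp_Q P *m v) + dotv (cp_a P) v + cp_c P.

Definition cp_feasible (N : nat) (P : convex_program N) (v : 'cV[R]_N) : Prop :=
  foldr (fun k Pr => satisfies k v /\ Pr) True (cp_constraints P).

Definition cp_solution (N : nat) (P : convex_program N) : 'cV[R]_N -> Prop :=
  minimizer (cp_feasible P) (cp_objective P).

(* The stacked vector of variables (z, t, w). *)
Definition stack (p k : nat) (z : 'cV[R]_p) (t : R) (w : 'cV[R]_k) :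
    'cV[R]_(p + (1 + k)) :=
  col_mx z (col_mx t%:M w).

End ConvexPrograms.

(* Main.v *)
(* Because the off-diagonal blocks of B(u) cancel in z^T B(u) z, every robust
   constraint says that a form which is affine in (z, t) and quadratic in the
   homogenized uncertainty s (1, u) is nonnegative on the cone |u| <= |s|; the
   convex term |S(u) x|^2 of the constraint on t is linearized in x by
     -|w|^2 = min_y (|y|^2 + 2 y^T w).
   The S-lemma turns nonnegativity on the cone into a linear matrix inequality
   in (z, t) and one multiplier tau >= 0; the multipliers form the vector w of
   additional variables. *)
Require Import Defs.
From mathcomp Require Import all_boot all_order all_algebra.
From mathcomp Require Import classical_sets reals ring lra.

Set Implicit Arguments.
Unset Strict Implicit.
Unset Printing Implicit Defensive.
Import Order.TTheory GRing.Theory Num.Theory.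
Local Open Scope ring_scope.

(** * Linear and bilinear forms *)

Section LinearForms.
Variable R : realType.

Definition linear_form (E : lmodType R) (f : E -> R) : Prop :=
  forall a u v, f (a *: u + v) = a * f u + f v.

Definition bilinear_form (E : lmodType R) (f : E -> E -> R) : Prop :=
  (forall w, linear_form (f^~ w)) /\ forall w, linear_form (f w).

Lemma linear_form0 (E : lmodType R) (f : E -> R) : linear_form f -> f 0 = 0.
Proof. by move=> fl; have := fl (-1) 0 0; rewrite scaler0 addr0; lra. Qed.

Lemma linear_form_sum (E : lmodType R) (f : E -> R) (I : finType)
    (c : I -> R) (u : I -> E) :
  linear_form f -> f (\sum_i c i *: u i) = \sum_i c i * f (u i).
Proof.
move=> fl; elim/big_rec2: _ => [|i x y _ <-]; first exact: linear_form0.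
exact: fl.
Qed.

Lemma linear_form_delta (p : nat) (f : 'cV[R]_p -> R) (v : 'cV[R]_p) :
  linear_form f -> f v = \sum_i v i 0 * f (delta_mx i 0).
Proof.
move=> fl; rewrite -(linear_form_sum _ _ fl); congr f.
by rewrite [LHS]matrix_sum_delta; apply: eq_bigr => i _; rewrite big_ord1.
Qed.

Lemma bilinear_formD (E : lmodType R) (f g : E -> E -> R) :
  bilinear_form f -> bilinear_form g ->
  bilinear_form (fun u v => f u v + g u v).
Proof.
move=> [fl fr] [gl gr]; split=> w a u v /=.
  by rewrite fl gl; ring.
by rewrite fr gr; ring.
Qed.

(** * The S-lemma *)

Lemma bilinear_form_line (E : lmodType R) (f : E -> E -> R) (u v : E) (s : R) :
  bilinear_form f ->
  f (s *: v + u) (s *: v + u) = f u u + s * (f u v + f v u) + s ^+ 2 * f v v.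
Proof. by move=> [fl fr]; rewrite fl !fr; ring. Qed.

(* The line [s |-> w + s v] meets the cone [b = 0] at parameters s1 < 0 < s2
   with s1 s2 = b w / b v; a positive combination of the two values of [a] there
   has no cross term. *)
Lemma S_lemma_pair (E : lmodType R) (a b : E -> E -> R) (v w : E) :
  bilinear_form a -> bilinear_form b ->
  (forall x, 0 <= b x x -> 0 <= a x x) ->
  b v v < 0 -> 0 < b w w -> a v v * b w w >= a w w * b v v.
Proof.
move=> ab bb ab0 bv bw.
(* Along the line [b] equals [b w w + 2 h s + s^2 b v v], and [D] is a quarter of its discriminant,
   positive because [b v v] and [b w w] have opposite signs. *)
set h := (b w v + b v w) / 2%:R; set D := h ^+ 2 - b v v * b w w.
have D0 : 0 <= D.
  by rewrite /D subr_ge0 (le_trans _ (sqr_ge0 h)) // nmulr_rle0 // ltW.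
set r := Num.sqrt D.
have r2 : r ^+ 2 = h ^+ 2 - b v v * b w w by rewrite sqr_sqrtr.
have hr : h ^+ 2 < r ^+ 2 by rewrite r2 ltrDl oppr_gt0 nmulr_rlt0.
have r0 : 0 < r.
  rewrite lt_neqAle sqrtr_ge0 andbT; apply/eqP => r0.
  by move: hr (sqr_ge0 h); rewrite -r0; nra.
have nv : b v v != 0 by rewrite lt_eqF.
have root s : (b v v * s + h) ^+ 2 = r ^+ 2 ->
    0 <= a (s *: v + w) (s *: v + w).
  move=> sr; apply: ab0; rewrite bilinear_form_line //.
  suff -> : b w w + s * (b w v + b v w) + s ^+ 2 * b v v = 0 by [].
  apply: (mulfI nv); move: sr; rewrite r2.
  have -> : b w v + b v w = 2 * h by rewrite /h; field.
  move=> sr; rewrite mulr0 -[RHS](subrr (h ^+ 2 - b v v * b w w)) -{1}sr; ring.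
pose val s := a w w + s * (a w v + a v w) + s ^+ 2 * a v v.
have : 0 <= val ((r - h) / b v v).
  by rewrite /val -bilinear_form_line //; apply: root; field.
have : 0 <= val ((- r - h) / b v v).
  by rewrite /val -bilinear_form_line //; apply: root; field.
have c1 : 0 < r + h by nra.
have c2 : 0 < r - h by nra.
(* The positive weights [r - h] and [r + h] are chosen so that the weighted sum of the two roots
   vanishes, which removes the cross term of [a]. *)
move=> /(mulr_ge0 (ltW c2)) p1 /(mulr_ge0 (ltW c1)) p2.
have := addr_ge0 p1 p2.
have -> : (r - h) * val ((- r - h) / b v v) + (r + h) * val ((r - h) / b v v) =
    (2 * r) * (a w w + (r ^+ 2 - h ^+ 2) / (b v v) ^+ 2 * a v v).
  by rewrite /val; field.
rewrite r2.
have -> : a w w + (h ^+ 2 - b v v * b w w - h ^+ 2) / b v v ^+ 2 * a v v =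
   (a w w * b v v - a v v * b w w) / b v v by field.
rewrite pmulr_rge0 ?mulr_gt0 // ler_ndivlMr // mul0r.
by rewrite subr_le0.
Qed.

(** The multiplier is the infimum of [a w w / b w w] over [0 < b w w], a set that [e] makes
    nonempty. It lies below these ratios by definition, and above those with [b v v < 0] by
    [S_lemma_pair]; where [b] vanishes the claim is the hypothesis itself. *)
Lemma S_lemma (E : lmodType R) (a b : E -> E -> R) (e : E) :
  bilinear_form a -> bilinear_form b -> 0 < b e e ->
  (forall x, 0 <= b x x -> 0 <= a x x) <->
  exists2 tau : R, 0 <= tau & forall x, 0 <= a x x - tau * b x x.
Proof.
move=> ab bb be; split=> [ab0|[tau tau0 h] x bx]; last first.
  by have := h x; rewrite subr_ge0; apply: le_trans; rewrite mulr_ge0.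
pose A : set R := [set a w w / b w w | w in [set w | 0 < b w w]]%classic.
have A0 : (A !=set0)%classic by exists (a e e / b e e), e.
have lbA : lbound A 0.
  by move=> _ [w /= bw <-]; rewrite divr_ge0 ?ab0 // ltW.
exists (inf A); first exact: lb_le_inf.
move=> v; rewrite subr_ge0; case: (ltgtP (b v v) 0) => [bv|bv|bv].
- rewrite -ler_ndivrMr //; apply: lb_le_inf => // _ [w /= bw <-].
  rewrite ler_pdivlMr // mulrAC ler_ndivrMr //.
  exact: S_lemma_pair.
- rewrite -ler_pdivlMr //; apply: ge_inf; first by exists 0.
  by exists v.
- by rewrite bv mulr0 ab0 // bv.
Qed.

(** * Quadratic forms as linear matrix inequalities *)

Definition polar_mx (d : nat) (f : 'cV[R]_d -> 'cV[R]_d -> R) : 'M[R]_d :=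
  \matrix_(i, j) ((f (delta_mx i 0) (delta_mx j 0) +
                   f (delta_mx j 0) (delta_mx i 0)) / 2%:R).

Lemma polar_mx_sym d (f : 'cV[R]_d -> 'cV[R]_d -> R) :
  (polar_mx f)^T = polar_mx f.
Proof. by apply/matrixP => i j; rewrite !mxE addrC. Qed.

Lemma dotvP d a (u v w : 'cV[R]_d) :
  dotv (a *: u + v) w = a * dotv u w + dotv v w.
Proof. by rewrite /dotv linearP mulmxDl -scalemxAl !mxE. Qed.

Lemma dotvZr d (a : R) (u v : 'cV[R]_d) : dotv u (a *: v) = a * dotv u v.
Proof. by rewrite /dotv -scalemxAr mxE. Qed.

Lemma dotvZl d (a : R) (u v : 'cV[R]_d) : dotv (a *: u) v = a * dotv u v.
Proof. by rewrite dotvC dotvZr dotvC. Qed.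

Lemma dotvE d (u v : 'cV[R]_d) : dotv u v = \sum_i u i 0 * v i 0.
Proof. by rewrite /dotv mxE; apply: eq_bigr => i _; rewrite mxE. Qed.

(** Averaging the double sum of [f y y] with its transpose does not change it, so a form that is not
    symmetric still yields the symmetric matrix that [LinearMatrixIneq] demands. *)
Lemma dotv_polar_mx d (f : 'cV[R]_d -> 'cV[R]_d -> R) (y : 'cV[R]_d) :
  bilinear_form f -> dotv y (polar_mx f *m y) = f y y.
Proof.
move=> [fl fr].
have E1 : f y y = \sum_i \sum_j y i 0 * y j 0 * f (delta_mx i 0) (delta_mx j 0).
  rewrite (linear_form_delta y (fl y)); apply: eq_bigr => i _.
  rewrite (linear_form_delta y (fr _)) big_distrr; apply: eq_bigr => j _.
  exact: mulrA.
have E2 : f y y = \sum_i \sum_j y i 0 * y j 0 * f (delta_mx j 0) (delta_mx i 0).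
  rewrite E1 exchange_big; apply: eq_bigr => i _; apply: eq_bigr => j _.
  by rewrite (mulrC (y i 0)).
apply: (@mulIf _ 2%:R); first by rewrite pnatr_eq0.
have -> : f y y * 2 = f y y + f y y by ring.
rewrite [X in X + _]E1 E2 -big_split dotvE big_distrl /=.
apply: eq_bigr => i _; rewrite mxE -big_split big_distrr big_distrl /=.
by apply: eq_bigr => j _; rewrite mxE /=; field.
Qed.

Definition lmi_constraint (N d : nat) (f0 : 'cV[R]_d -> 'cV[R]_d -> R)
    (f : 'cV[R]_N -> 'cV[R]_d -> 'cV[R]_d -> R) : convex_constraint R N :=
  LinearMatrixIneq (polar_mx_sym f0)
    (fun i => polar_mx_sym (f (delta_mx i 0))).

(** Since [f] is linear in [v], the quadratic form of the matrix pencil at [v] is [f0 + f v] on the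
    diagonal. *)
Lemma satisfies_lmi_constraint N d (f0 : 'cV[R]_d -> 'cV[R]_d -> R)
    (f : 'cV[R]_N -> 'cV[R]_d -> 'cV[R]_d -> R) (v : 'cV[R]_N) :
  bilinear_form f0 -> (forall v, bilinear_form (f v)) ->
  (forall x y, linear_form (fun v => f v x y)) ->
  satisfies (lmi_constraint f0 f) v <-> forall y, 0 <= f0 y y + f v y y.
Proof.
move=> b0 b1 l1 /=; set A := (X in psdmx X).
have AE y : dotv y (A *m y) = f0 y y + f v y y.
  rewrite /A mulmxDl dotvDr dotv_polar_mx //; congr (_ + _).
  rewrite (linear_form_delta v (l1 y y)) mulmx_suml.
  have y0 : dotv y 0 = 0 by rewrite /dotv mulmx0 mxE.
  rewrite (big_morph (dotv y) (dotvDr y) y0); apply: eq_bigr => i _.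
  by rewrite -dotv_polar_mx // /dotv -scalemxAl -scalemxAr mxE.
split=> [[_ h] y|h]; first by rewrite -AE.
split=> [|y]; last by rewrite AE.
rewrite /A linearD /= polar_mx_sym linear_sum /=; congr (_ + _).
by apply: eq_bigr => i _; rewrite linearZ /= polar_mx_sym.
Qed.

(** * Convex programs for constraints on a cone *)

Lemma cp_feasible_cat N (Q : 'M[R]_N) (Qpsd : psdmx Q) a c s1 s2 v :
  cp_feasible (ConvexProgram Qpsd a c (s1 ++ s2)) v <->
  cp_feasible (ConvexProgram Qpsd a c s1) v /\
  cp_feasible (ConvexProgram Qpsd a c s2) v.
Proof. by rewrite /cp_feasible /=; elim: s1 => [|k s1 IH] /=; tauto. Qed.

Lemma cp_feasible_enum N (Q : 'M[R]_N) (Qpsd : psdmx Q) a c (J : finType)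
    (k : J -> convex_constraint R N) v :
  cp_feasible (ConvexProgram Qpsd a c [seq k j | j <- enum J]) v <->
  forall j, satisfies (k j) v.
Proof.
rewrite /cp_feasible /=.
have -> : (forall j, satisfies (k j) v) <->
    forall j, j \in enum J -> satisfies (k j) v.
  by split=> h j => [_|]; apply: h => //; rewrite mem_enum.
elim: (enum J) => [//|j0 s IH] /=; split.
  move=> [h0 /IH h] j; rewrite in_cons => /orP[/eqP->//|]; exact: h.
move=> h; split; first by apply: h; rewrite mem_head.
by apply/IH => j js; apply: h; rewrite in_cons js orbT.
Qed.

Lemma psdmx0 N : psdmx (0 : 'M[R]_N).
Proof. by split=> [|v]; rewrite ?trmx0 // mul0mx /dotv mulmx0 mxE. Qed.

Lemma dotv_delta_mx N (v : 'cV[R]_N) i : dotv (delta_mx i 0) v = v i 0.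
Proof.
rewrite dotvE (bigD1 i) //= mxE !eqxx mul1r big1 ?addr0 // => j ji.
by rewrite mxE (negPf ji) mul0r.
Qed.

Lemma stackK p k (v : 'cV[R]_(p + (1 + k))) :
  stack (usubmx v) (usubmx (dsubmx v) 0 0) (dsubmx (dsubmx v)) = v.
Proof. by rewrite /stack -mx11_scalar !vsubmxK. Qed.

(** Each constraint indexed by [J] is traded, by the S-lemma with common interior point [e], for one
    linear matrix inequality and one multiplier stored in [w]. *)
Lemma cone_program (p d : nat) (J : finType)
    (b : 'cV[R]_d -> 'cV[R]_d -> R) (e : 'cV[R]_d)
    (f0 : J -> 'cV[R]_d -> 'cV[R]_d -> R)
    (f : J -> 'cV[R]_p -> R -> 'cV[R]_d -> 'cV[R]_d -> R) :
  bilinear_form b -> 0 < b e e ->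
  (forall j, bilinear_form (f0 j)) ->
  (forall j z t, bilinear_form (f j z t)) ->
  (forall j a z z' t t' x y,
    f j (a *: z + z') (a * t + t') x y = a * f j z t x y + f j z' t' x y) ->
  exists (k : nat) (P : convex_program R (p + (1 + k))),
    (forall z t w, cp_objective P (stack z t w) = t) /\
    forall z t,
      (forall j y, 0 <= b y y -> 0 <= f0 j y y + f j z t y y) <->
      exists w : 'cV[R]_k, cp_feasible P (stack z t w).
Proof.
move=> bb be b0 b1 l1.
pose k := #|J|; exists k.
pose iw (j : J) : 'I_(p + (1 + k)) := rshift p (rshift 1 (enum_rank j)).
(* The multiplier of [j] is the coordinate [iw j] of [v] and the form [b] is fixed, so the
   subtracted term stays linear in [v]. *)
pose g j (v : 'cV[R]_(p + (1 + k))) x y :=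
  f j (usubmx v) (usubmx (dsubmx v) 0 0) x y - v (iw j) 0 * b x y.
pose it : 'I_(p + (1 + k)) := rshift p (lshift k 0).
(* The objective reads off the coordinate [it] of [t]; the affine constraints make the multipliers
   nonnegative. *)
pose P := ConvexProgram (@psdmx0 _) (delta_mx it 0) 0
  ([seq lmi_constraint (f0 j) (g j) | j <- enum J] ++
   [seq AffineLe (- delta_mx (iw j) 0) 0 | j <- enum J]).
have stE z t w : stack z t w it 0 = t.
  by rewrite /stack col_mxEd col_mxEu mxE eqxx.
have swE z t w j : stack z t w (iw j) 0 = w (enum_rank j) 0.
  by rewrite /stack !col_mxEd.
exists P; split=> z t.
  move=> w; rewrite /cp_objective /= mul0mx {1}/dotv mulmx0 mxE.
  by rewrite add0r addr0 dotv_delta_mx stE.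
have gb j v : bilinear_form (g j v).
  have [fl fr] := b1 j (usubmx v) (usubmx (dsubmx v) 0 0).
  case: (bb) => bl br.
  by split=> w a x y; rewrite /g ?fl ?bl ?fr ?br; ring.
have gl j x y : linear_form (fun v => g j v x y).
  by move=> a v v'; rewrite /g !linearP /= !mxE l1; ring.
have feasE w : cp_feasible P (stack z t w) <-> forall j,
    0 <= w (enum_rank j) 0 /\
    forall y, 0 <= f0 j y y + f j z t y y - w (enum_rank j) 0 * b y y.
  have gE j y : f0 j y y + g j (stack z t w) y y =
      f0 j y y + f j z t y y - w (enum_rank j) 0 * b y y.
    by rewrite /g swE addrA /stack col_mxKu col_mxKd col_mxKu mxE eqxx.
  rewrite cp_feasible_cat !cp_feasible_enum.
  split=> [[h1 h2] j|h].
    split.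
      have := h2 j; rewrite /= dotvC dotvNr dotvC dotv_delta_mx swE.
      by rewrite oppr_le0.
    move=> y; rewrite -gE.
    by have /satisfies_lmi_constraint := h1 j; apply.
  split=> j.
    apply/satisfies_lmi_constraint => // y; rewrite gE.
    by have [] := h j.
  rewrite /= dotvC dotvNr dotvC dotv_delta_mx swE oppr_le0.
  by have [] := h j.
have SJ j := S_lemma (bilinear_formD (b0 j) (b1 j z t)) bb be.
split=> [h|[w /feasE h] j y by0].
  have /fin_all_exists [tau tauP] j : exists tau : R, 0 <= tau /\
      forall y, 0 <= f0 j y y + f j z t y y - tau * b y y.
    by have [tau ? ?] := (SJ j).1 (h j); exists tau.
  exists (\col_i tau (enum_val i)); apply/feasE => j.
  by rewrite mxE enum_rankK.
have [w0 hw] := h j.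
by apply: (SJ j).2 by0; exists (w (enum_rank j) 0).
Qed.

End LinearForms.

(** * Homogenization of the robust counterpart *)

Section RobustCounterpart.
Variables (R : realType) (n m L : nat).
Variables (S : 'I_L.+1 -> 'M[R]_n) (q : 'I_L.+1 -> 'cV[R]_n).
Variables (C : 'I_L.+1 -> 'M[R]_(m, n)) (b : 'I_L.+1 -> 'cV[R]_m).

(** Coordinate 0 replaces the constant 1 in front of [A ord0], turning the affine dependence on the
    uncertainty into a linear one. *)
Definition homogenize (E : lmodType R) (A : 'I_L.+1 -> E)
    (u : 'cV[R]_(1 + L)) : E :=
  \sum_(l < L.+1) u l 0 *: A l.

Lemma homogenizeP (E : lmodType R) (A : 'I_L.+1 -> E) a u v :
  homogenize A (a *: u + v) = a *: homogenize A u + homogenize A v.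
Proof.
rewrite /homogenize scaler_sumr -big_split; apply: eq_bigr => l _.
by rewrite !mxE scalerDl scalerA.
Qed.

Lemma homogenizeE (E : lmodType R) (A : 'I_L.+1 -> E) s u :
  homogenize A (s *: col_mx 1 u) = s *: affine_family A u.
Proof.
have -> : s *: col_mx 1 u = s *: col_mx 1 u + 0 by rewrite addr0.
rewrite homogenizeP [X in _ + X]big1 ?addr0; last first.
  by move=> l _; rewrite mxE scale0r.
congr (_ *: _); rewrite /homogenize big_ord_recl; congr (_ + _).
  rewrite (_ : ord0 = lshift L (0 : 'I_1)); last exact: val_inj.
  by rewrite col_mxEu mxE eqxx scale1r.
by apply: eq_bigr => l _; rewrite -rshift1 col_mxEd.
Qed.

(* A point [col_mx (s (1, u)) y] collects the homogenized uncertainty s (1, u)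
   and the auxiliary vector [y] of the constraint on t; the form
   is s^2 (1 - |u|^2). *)
Definition ball_form (y w : 'cV[R]_(1 + L + n)) : R :=
  usubmx (usubmx y) 0 0 * usubmx (usubmx w) 0 0 -
  dotv (dsubmx (usubmx y)) (dsubmx (usubmx w)).

(** The part depending on [(z, t)] of the homogenized constraint on [t], with [|S(u) x|^2]
    linearized through [dsubmx y]. No [C] occurs, as its two blocks cancel; the square of the
    auxiliary vector enters through [cone_form0]. *)
Definition complementarity_form (z : 'cV[R]_(n + m)) (t : R)
    (y w : 'cV[R]_(1 + L + n)) : R :=
  let s y := usubmx (usubmx y) 0 0 in
  t * s y * s w - s y * dotv (usubmx z) (homogenize q (usubmx w)) +
  s y * dotv (dsubmx z) (homogenize b (usubmx w)) +
  2 * dotv (dsubmx y) (homogenize S (usubmx w) *m usubmx z).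

(** The part linear in [z] of [p^T (B(u) z + d(u))], made homogeneous of degree two in [s (1, u)]:
    the [S] term already has degree two, the [C] terms receive a factor [s]. The part free of [z] is
    [slack_form0]. *)
Definition slack_form (p z : 'cV[R]_(n + m)) (y w : 'cV[R]_(1 + L + n)) : R :=
  let s y := usubmx (usubmx y) 0 0 in
  dotv (homogenize S (usubmx y) *m usubmx p)
       (homogenize S (usubmx w) *m usubmx z) -
  s y * dotv (homogenize C (usubmx w) *m usubmx p) (dsubmx z) +
  s y * dotv (dsubmx p) (homogenize C (usubmx w) *m usubmx z).

Definition slack_form0 (p : 'cV[R]_(n + m)) (y w : 'cV[R]_(1 + L + n)) : R :=
  let s y := usubmx (usubmx y) 0 0 in
  s y * dotv (usubmx p) (homogenize q (usubmx w)) -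
  s y * dotv (dsubmx p) (homogenize b (usubmx w)).

Ltac multilinear :=
  rewrite ?linearP /= ?homogenizeP ?mulmxDl ?mulmxDr -?scalemxAl -?scalemxAr
    ?(dotvP, dotvDr) ?dotvZr ?mxE; ring.

Lemma ball_form_bilinear : bilinear_form ball_form.
Proof. by split=> w a u v; rewrite /ball_form; multilinear. Qed.

Lemma complementarity_form_bilinear z t :
  bilinear_form (complementarity_form z t).
Proof. by split=> w a u v; rewrite /complementarity_form; multilinear. Qed.

Lemma slack_form_bilinear p z : bilinear_form (slack_form p z).
Proof. by split=> w a u v; rewrite /slack_form; multilinear. Qed.

Lemma slack_form0_bilinear p : bilinear_form (slack_form0 p).
Proof. by split=> w a u v; rewrite /slack_form0; multilinear. Qed.

Lemma complementarity_formP a z z' t t' y w :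
  complementarity_form (a *: z + z') (a * t + t') y w =
  a * complementarity_form z t y w + complementarity_form z' t' y w.
Proof. rewrite /complementarity_form; multilinear. Qed.

Lemma slack_formP p a z z' y w :
  slack_form p (a *: z + z') y w = a * slack_form p z y w + slack_form p z' y w.
Proof. rewrite /slack_form; multilinear. Qed.

Definition factored_VI (u : 'cV[R]_L) : affineVI R n m :=
  AffineVI ((affine_family S u)^T *m affine_family S u)
    (affine_family q u) (affine_family C u) (affine_family b u).

Lemma dotv_lcp (p z : 'cV[R]_(n + m)) u :
  dotv p (lcp_B (factored_VI u) *m z + lcp_d (factored_VI u)) =
  dotv (affine_family S u *m usubmx p) (affine_family S u *m usubmx z) -
  dotv (affine_family C u *m usubmx p) (dsubmx z) +
  dotv (dsubmx p) (affine_family C u *m usubmx z) +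
  dotv (usubmx p) (affine_family q u) - dotv (dsubmx p) (affine_family b u).
Proof.
have dotv_col p1 p2 (w1 : 'cV[R]_n) (w2 : 'cV[R]_m) :
    dotv (col_mx p1 p2) (col_mx w1 w2) = dotv p1 w1 + dotv p2 w2.
  by rewrite /dotv tr_col_mx mul_row_col mxE.
rewrite /lcp_B /lcp_d -[in LHS](vsubmxK p) -[in LHS](vsubmxK z).
rewrite mul_block_col mul0mx addr0 add_col_mx dotv_col /=.
move: (affine_family q u) (affine_family b u) => qu bu.
rewrite !dotvDr mulNmx !dotvNr.
by rewrite -mulmxA !dotv_mull; ring.
Qed.

Lemma slack_formE (p z : 'cV[R]_(n + m)) s u y :
  let v := col_mx (s *: col_mx 1 u) y in
  slack_form0 p v v + slack_form p z v v =
  s ^+ 2 * dotv p (lcp_B (factored_VI u) *m z + lcp_d (factored_VI u)).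
Proof.
rewrite /= dotv_lcp /slack_form0 /slack_form !col_mxKu !homogenizeE linearZ /=.
by rewrite !col_mxKu -!scalemxAl !(dotvZr, dotvZl) !mxE !eqxx /=; ring.
Qed.

(** Completing the square in [y] leaves [- s^2 |S(u) x|^2], the convex term of the complementarity
    product; [r] vanishes at the minimizing [y]. *)
Lemma complementarity_formE (z : 'cV[R]_(n + m)) t s u y :
  let v := col_mx (s *: col_mx 1 u) y in
  let r := y + s *: (affine_family S u *m usubmx z) in
  dotv y y + complementarity_form z t v v =
  s ^+ 2 * (t - dotv z (lcp_B (factored_VI u) *m z + lcp_d (factored_VI u))) +
  dotv r r.
Proof.
rewrite /= dotv_lcp /complementarity_form !col_mxKu !homogenizeE linearZ /=.
rewrite !col_mxKu col_mxKd -!scalemxAl !dotvZr !mxE !eqxx /=.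
set w := affine_family S u *m usubmx z.
move: (affine_family q u) (affine_family b u) => qu bu.
rewrite [dotv (affine_family C u *m _) _]dotvC !dotvDr !dotvZr.
by rewrite ![dotv (y + _) _]dotvC !dotvDr !dotvZr [dotv w y]dotvC; ring.
Qed.

(** * The cone over the unit ball *)

Lemma dotv_ge0 d (v : 'cV[R]_d) : 0 <= dotv v v.
Proof. by rewrite dotvE sumr_ge0 // => i _; rewrite -expr2 sqr_ge0. Qed.

Lemma unit_ball2E (u : 'cV[R]_L) : unit_ball2 u <-> dotv u u <= 1.
Proof.
by rewrite /unit_ball2 /= /norm2 -[X in _ <= X]sqrtr1 ler_sqrt ?ltr01.
Qed.

Lemma ball_formE s u y :
  let v := col_mx (s *: col_mx 1 u) y in
  ball_form v v = s ^+ 2 * (1 - dotv u u).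
Proof.
rewrite /= /ball_form !col_mxKu !linearZ /= col_mxKu col_mxKd.
by rewrite dotvZr dotvZl !mxE eqxx /=; ring.
Qed.

(** For [s] nonzero, divide the uncertainty by [s]. For [s = 0] the inequality forces the
    uncertainty part to vanish, and the centre of the ball serves as [u]. *)
Lemma ball_form_ge0P v : 0 <= ball_form v v ->
  exists s u y, unit_ball2 u /\ v = col_mx (s *: col_mx 1 u) y.
Proof.
rewrite -(vsubmxK v) -(vsubmxK (usubmx v)) [usubmx (usubmx v)]mx11_scalar.
move: (usubmx _ _ _) (dsubmx (usubmx v)) (dsubmx v) => s u y.
rewrite /ball_form !col_mxKu col_mxKd !mxE eqxx mulr1n => h.
have [s0|s0] := eqVneq s 0.
  have u0 : u = 0.
    have uu : \sum_i u i 0 * u i 0 = 0.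
      apply: le_anti; rewrite -dotvE dotv_ge0 andbT.
      by move: h; rewrite s0 mulr0 sub0r oppr_ge0.
    apply/colP => i; rewrite mxE; apply/eqP; rewrite -sqrf_eq0 expr2.
    by rewrite (psumr_eq0P _ uu) // => j _; rewrite -expr2 sqr_ge0.
  exists 0, 0, y; split; last by rewrite s0 u0 scale0r -col_mx0 raddf0.
  by apply/unit_ball2E; rewrite /dotv mulmx0 mxE.
exists s, (s^-1 *: u), y; split.
  apply/unit_ball2E; rewrite dotvZr dotvZl mulrA -invfM.
  by rewrite -expr2 ler_pdivrMl ?exprn_even_gt0 // mulr1 -subr_ge0 expr2.
by rewrite scale_col_mx scalerA mulfV // scale1r scalemx1.
Qed.

(** The index [None] stands for the constraint on [t], [inl i] for row [i] of the slack and [inr i]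
    for the sign of [z i 0], multiplied by [s^2] to share the shape of the others. This is the part
    free of [(z, t)]. *)
Definition cone_form0 (j : option ('I_(n + m) + 'I_(n + m))) y w : R :=
  match j with
  | None => dotv (dsubmx y) (dsubmx w)
  | Some (inl i) => slack_form0 (delta_mx i 0) y w
  | Some (inr i) => 0
  end.

Definition cone_form (j : option ('I_(n + m) + 'I_(n + m))) z t y w : R :=
  match j with
  | None => complementarity_form z t y w
  | Some (inl i) => slack_form (delta_mx i 0) z y w
  | Some (inr i) => z i 0 * usubmx (usubmx y) 0 0 * usubmx (usubmx w) 0 0
  end.

(** On a cone point each form is [s^2] times the slack in a robust constraint, plus a square in the
    case of [t]; conversely, each robust constraint is recovered at [s = 1]. *)
Lemma robust_feasible_cone z t :
  robust_feasible (@unit_ball2 R L) factored_VI (z, t) <->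
  forall j y, 0 <= ball_form y y -> 0 <= cone_form0 j y y + cone_form j z t y y.
Proof.
split=> [[/= h1 h2 h3] j y /ball_form_ge0P[s [u [r [Uu ->]]]]|h].
  case: j => [[i|i]|] /=.
  - rewrite slack_formE dotv_delta_mx mulr_ge0 ?sqr_ge0 //.
    by have := h2 u Uu i; rewrite [X in X <= _]mxE.
  - rewrite add0r -mulrA -expr2 mulr_ge0 ?sqr_ge0 //.
    by have := h3 i; rewrite mxE.
  - rewrite col_mxKd complementarity_formE addr_ge0 ?dotv_ge0 //.
    by rewrite mulr_ge0 ?sqr_ge0 // subr_ge0 h1.
have hU u r : unit_ball2 u ->
    let y := col_mx (1 *: col_mx 1 u) r in forall j,
    0 <= cone_form0 j y y + cone_form j z t y y.
  move=> /unit_ball2E Uu y j; apply: h.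
  by rewrite ball_formE expr1n mul1r subr_ge0.
split=> /= [u Uu|u Uu i|i].
(* This auxiliary vector minimizes the linearization, so the square disappears and the constraint on
   [t] remains. *)
- have := hU u (- (affine_family S u *m usubmx z)) Uu None.
  rewrite /= col_mxKd complementarity_formE scale1r addNr.
  by rewrite {2}/dotv mulmx0 mxE addr0 expr1n mul1r subr_ge0.
- have := hU u 0 Uu (Some (inl i)).
  by rewrite /= slack_formE expr1n mul1r dotv_delta_mx [X in _ -> X <= _]mxE.
(* The sign constraints do not involve [u], so any point of the ball would do. *)
- have U0 : @unit_ball2 R L 0 by apply/unit_ball2E; rewrite /dotv mulmx0 mxE.
  have := hU 0 0 U0 (Some (inr i)).
  by rewrite /= !col_mxKu scale1r col_mxKu !mxE eqxx !mulr1 add0r.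
Qed.

End RobustCounterpart.

Theorem proposition5p1 (R : realType) (n m L : nat)
    (S : 'I_L.+1 -> 'M[R]_n) (q : 'I_L.+1 -> 'cV[R]_n)
    (C : 'I_L.+1 -> 'M[R]_(m, n)) (b : 'I_L.+1 -> 'cV[R]_m) :
  let U := @unit_ball2 R L in
  let M (u : 'cV[R]_L) := (affine_family S u)^T *m affine_family S u in
  let V (u : 'cV[R]_L) :=
    AffineVI (M u) (affine_family q u) (affine_family C u) (affine_family b u) in
  exists (k : nat) (P : convex_program R ((n + m) + (1 + k))),
    [/\ forall (z : 'cV[R]_(n + m)) (t : R) (w : 'cV[R]_k),
          cp_objective P (stack z t w) = t,
        forall (z : 'cV[R]_(n + m)) (t : R),
          robust_feasible U V (z, t) <->
          exists w : 'cV[R]_k, cp_feasible P (stack z t w)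
      & forall (z : 'cV[R]_(n + m)) (t : R),
          robust_solution U V z t <->
          exists w : 'cV[R]_k, cp_solution P (stack z t w)].
Proof.
move=> U M V.
have [k [P [obj feas]]] : exists k (P : convex_program R ((n + m) + (1 + k))),
    (forall z t w, cp_objective P (stack z t w) = t) /\
    forall z t,
      (forall j y, 0 <= ball_form y y ->
        0 <= cone_form0 q b j y y + cone_form S q C b j z t y y) <->
      exists w : 'cV[R]_k, cp_feasible P (stack z t w).
  (* The point with [s = 1], [u = 0] and zero auxiliary vector is interior to the cone: [ball_form]
     equals 1 there. *)
  apply: (cone_program (e := col_mx (1 *: col_mx 1 0) 0)).
  - exact: ball_form_bilinear.
  - by rewrite ball_formE /dotv mulmx0 mxE subr0 expr1n mulr1.
  - case=> [[i|i]|] /=.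
    + exact: slack_form0_bilinear.
    + by split=> w a x y /=; ring.
    + by split=> w a x y /=; rewrite linearP ?dotvP ?dotvDr ?dotvZr.
  - case=> [[i|i]|] z t /=.
    + exact: slack_form_bilinear.
    + by split=> w a x y /=; rewrite !linearP !mxE; ring.
    + exact: complementarity_form_bilinear.
  - case=> [[i|i]|] a z z' t t' x y /=.
    + exact: slack_formP.
    + by rewrite !mxE; ring.
    + exact: complementarity_formP.
have {}feas z t : robust_feasible U V (z, t) <->
    exists w : 'cV[R]_k, cp_feasible P (stack z t w).
  by rewrite -feas -robust_feasible_cone.
exists k, P; split=> // z t; split.
  move=> [/feas [w fw] opt]; exists w; split=> // v'.
  (* Every competitor [v'] splits as a stack, so its objective value is its own [t]-coordinate and
     optimality in [(z, t)] applies. *)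
  rewrite obj -(stackK v') obj => fv'.
  apply: (opt (usubmx v', _)); apply/feas.
  by exists (dsubmx (dsubmx v')).
move=> [w [fw opt]]; split; first by apply/feas; exists w.
by move=> [z' t'] /feas [w' fw'] /=; have := opt _ fw'; rewrite !obj.
Qed.
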